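(* Let $K\ge 1$ and let $\lambda_i>0$, $c_i>0$ for $i=1,\dots,K$. Let $\eta_1,\dots,\eta_K$ be independent random variables with $\eta_i\sim\mathrm{GG}(\lambda_i,c_i,1)$. Then: (i) if $\Psi=\prod_{i=1}^K \eta_i$, the sparsity shape parameter of $\Psi$ equals $\min\{\lambda_1,\dots,\lambda_K\}$; (ii) if $\Psi=\sum_{i=1}^K \eta_i$, the sparsity shape parameter of $\Psi$ equals $\sum_{i=1}^K \lambda_i$.
   Context: The gamma-gamma distribution $\mathrm{GG}(\lambda,c,d)$ with $\lambda,c,d>0$ is the distribution on $(0,\infty)$ with density $$g(\Psi)=\left(\frac{1}{d}\right)^{\lambda}\frac{\Gamma(\lambda+c)}{\Gamma(\lambda)\Gamma(c)}\Psi^{\lambda-1}\left(1+\frac{\Psi}{d}\right)^{-(\lambda+c)}.$$ For a positive random variable $\Psi$ with density $p$ on $(0,\infty)$, its sparsity shape parameter is defined as $$\sup\left\{ z \;\middle|\; \frac{p(\Psi)}{\Psi^{z-1}}\to \kappa \text{ as } \Psi\to 0 \text{ for some finite } \kappa\right\}.$$ *)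

(* Defs.v *)
From HB Require Import structures.
From mathcomp Require Import all_boot all_order all_algebra.
From mathcomp Require Import all_classical all_reals all_analysis.
Set Implicit Arguments. Unset Strict Implicit. Unset Printing Implicit Defensive.
Import Order.TTheory GRing.Theory Num.Theory.
Import numFieldNormedType.Exports.
Local Open Scope classical_set_scope.
Local Open Scope ring_scope.

Section defs.
Context {R : realType}.

Definition Gamma (a : R) : R :=
  Rintegral lebesgue_measure `]0%R, +oo[ (fun x => x `^ (a - 1) * expR (- x)).

Definition gg_pdf (lam c d : R) (x : R) : R :=
  if 0 < x then
    (d^-1) `^ lam * (Gamma (lam + c) / (Gamma lam * Gamma c))
    * x `^ (lam - 1) * (1 + x / d) `^ (- (lam + c))
  else 0.

Definition has_density {d} {T : measurableType d} (P : probability T R)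
  (X : T -> R) (f : R -> R) : Prop :=
  forall A : set R, measurable A ->
    P (X @^-1` A) = (\int[lebesgue_measure]_(x in A) (f x)%:E)%E.

(* mutual independence of a finite family of real random variables:
   the joint law is the product of the marginals (taking B i = setT
   recovers every subfamily) *)
Definition mutually_independent {d} {T : measurableType d}
  (P : probability T R) (K : nat) (X : 'I_K -> {RV P >-> R}) : Prop :=
  forall B : 'I_K -> set R, (forall i, measurable (B i)) ->
    P (\bigcap_(i in [set: 'I_K]) (X i @^-1` B i)) =
    (\prod_(i < K) P (X i @^-1` B i))%E.

Definition sparsity_shape (p : R -> R) : \bar R :=
  ereal_sup [set z%:E | z in
    [set z : R | exists kappa : R,
       p x / x `^ (z - 1) @[x --> 0^'+] --> kappa]].

Definition continuous_on_pos (p : R -> R) : Prop :=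
  forall x : R, 0 < x -> {for x, continuous p}.

(* "the sparsity shape parameter of (the law of) X equals v": X has a
   density continuous on (0, oo) (such a version is unique), and the
   sparsity shape parameter of (any) such density equals v *)
Definition sparsity_of_rv_is {d} {T : measurableType d}
  (P : probability T R) (X : T -> R) (v : \bar R) : Prop :=
  (exists p, has_density P X p /\ continuous_on_pos p) /\
  (forall p, has_density P X p -> continuous_on_pos p -> sparsity_shape p = v).

End defs.

(* Main.v *)
(* If a density p on (0, oo) satisfies c x^v <= x p(x) near 0, and
   x p(x) <= C x^z near 0 for every 0 <= z < v, then its sparsity shape
   parameter is v, and a density that is continuous on (0, oo) is determined
   there by the law. So it suffices to build continuous densities of the
   partial sums and products by iterated convolution and to propagate power
   bounds. For a sum, the substitution y = x t turns the convolution at x into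
   x^(a + b - 1) times a Beta integral, up to constants, so exponents add. For a
   product, x p(x) is the multiplicative convolution of the factors u f(u), and
   each factor's lower bound is inherited by restricting the integral to a
   suitable window, while the upper bound x^z, z < min lam_i, only needs the
   finite moment E[eta^(-z)]. *)
Require Import Defs.
From HB Require Import structures.
From mathcomp Require Import all_boot all_order all_algebra.
From mathcomp Require Import all_classical all_reals all_analysis.
From mathcomp Require Import measurable_realfun ring lra.
Set Implicit Arguments.
Unset Strict Implicit.
Unset Printing Implicit Defensive.

Import Order.TTheory GRing.Theory Num.Theory.
Import numFieldNormedType.Exports.
Local Open Scope classical_set_scope.
Local Open Scope ring_scope.

(** * Change of variables *)

(** Upper bounds stop short of the exponent [v] because at [v] itself they can fail: when exactly
    two factors of a product share the least exponent, [x p(x)] is of order [x^v log(1/x)] at 0, so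
    the supremum need not be attained. Both convolutions are instances of one formula for the law of
    [op(X, Y)], given the density of [op(X, y)] at fixed [y]. To iterate it, each partial result
    must be independent of the next variable; this is extracted from mutual independence by
    uniqueness of measures that agree on rectangles. The power bounds serve twice: they give the
    exponents, and they provide the integrable majorants that make each new density continuous by
    dominated convergence. *)

Section integral_density.
Context {d} {T : measurableType d} {R : realType}.
Context (mu m : {measure set T -> \bar R}) (g : T -> R).
Hypothesis mg : measurable_fun [set: T] g.
Hypothesis g0 : forall x, 0 <= g x.
Hypothesis mgE : forall A, measurable A -> m A = (\int[mu]_(x in A) (g x)%:E)%E.
Import HBNNSimple.

Lemma integral_density_nnsfun (f : {nnsfun T >-> R}) :
  (\int[m]_x (f x)%:E = \int[mu]_x ((f x)%:E * (g x)%:E))%E.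
Proof.
under [LHS]eq_integral do rewrite fimfunE -fsumEFin//.
rewrite [LHS]ge0_integral_fsum//; last 2 first.
  - by move=> r; exact/measurable_EFinP/measurableT_comp.
  - by move=> n x _; rewrite EFinM nnfun_muleindic_ge0.
under [RHS]eq_integral.
  move=> x xD; rewrite fimfunE -fsumEFin// ge0_mule_fsuml; last first.
    by move=> r; rewrite EFinM nnfun_muleindic_ge0.
  over.
rewrite [RHS]ge0_integral_fsum//; last 2 first.
  - move=> r; apply: emeasurable_funM; apply/measurable_EFinP => //.
    by do 2 apply/measurableT_comp => //.
  - move=> n x _; apply: mule_ge0; last by rewrite lee_fin.
    by rewrite EFinM nnfun_muleindic_ge0.
apply: eq_fsbigr => r /[!inE] -[t _ ftr].
have r0 : (0 <= r)%R by rewrite -ftr.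
have mfr : measurable (f @^-1` [set r]) by [].
rewrite integralZl_indic_nnsfun// integral_indic// setIT mgE//.
rewrite integral_mkcond -ge0_integralZl//.
- apply: eq_integral => x _; rewrite EFinM -muleA; congr (_ * _)%E.
  rewrite patchE indicE; case: ifPn => xE; first by rewrite mul1e.
  by rewrite mul0e.
- apply/(measurable_restrictT (EFin \o g)) => //; apply/measurable_EFinP.
  exact: measurable_funS mg.
- by move=> x _; apply: erestrict_ge0 => ? _; rewrite lee_fin.
Qed.

(** Monotone convergence along simple functions. The measure [m] is known only through its values on
    sets, which is the form in which the law of a random variable with a density is given. *)
Lemma ge0_integral_density (f : T -> \bar R) :
  measurable_fun [set: T] f -> (forall x, 0 <= f x)%E ->
  (\int[m]_x f x = \int[mu]_x (f x * (g x)%:E))%E.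
Proof.
move=> mf f0.
pose f_ := nnsfun_approx measurableT mf.
transitivity (lim (\int[m]_x (f_ n x)%:E @[n --> \oo])%E).
  rewrite -monotone_convergence//=.
  - apply: eq_integral => ? /[!inE] xD; apply/esym/cvg_lim => //=.
    exact: cvg_nnsfun_approx.
  - by move=> n; exact/measurable_EFinP/measurable_funTS.
  - by move=> n ? _; rewrite lee_fin.
  - by move=> ? _ ? ? mn; rewrite lee_fin; exact/lefP/nd_nnsfun_approx.
rewrite [RHS](_ : _ = lim
    (\int[mu]_x ((f_ n x)%:E * (g x)%:E)%E @[n --> \oo])%E); last first.
  rewrite -monotone_convergence//=.
  - apply: eq_integral => x /[!inE] xD; apply/esym/cvg_lim => //.
    have cf : (f_ n x)%:E @[n --> \oo] --> f x by exact: cvg_nnsfun_approx.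
    by apply: cvgeZr.
  - by move=> n; apply: emeasurable_funM; exact/measurable_EFinP/measurable_funTS.
  - by move=> n x _; apply: mule_ge0; rewrite lee_fin.
  - move=> x _ a b ab; apply: lee_wpmul2r; rewrite lee_fin//.
    exact/lefP/nd_nnsfun_approx.
by apply: congr_lim; apply/funext => n /=; exact: integral_density_nnsfun.
Qed.

End integral_density.

(** The measure sending [A] to [|s|] times the length of its preimage agrees with Lebesgue measure
    on half-open intervals, hence everywhere. Translations, dilations and the reflection of the unit
    interval are all taken from here. *)
Lemma ge0_integral_affine {R : realType} (s t : R) (f : R -> \bar R) :
  s != 0 -> measurable_fun [set: R] f -> (forall x, 0 <= f x)%E ->
  (\int[lebesgue_measure]_x f x =
   `|s|%:E * \int[lebesgue_measure]_x f (s * x + t)%R)%E.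
Proof.
move=> s0 mf f0.
pose phi : measurableTypeR R -> measurableTypeR R := fun x => s * x + t.
have mphi : measurable_fun [set: measurableTypeR R] phi.
  by apply: measurable_funD => //; apply: measurable_funM.
pose m0 : {measure set (measurableTypeR R) -> \bar R} :=
  measure_function_pushforward__canonical__measure_function_Measure (@lebesgue_measure R) mphi.
pose m : {measure set (measurableTypeR R) -> \bar R} :=
  mscale (NngNum (normr_ge0 s)) m0.
have mE A : measurable A -> lebesgue_measure A = m A.
  move=> mA; apply: lebesgue_measure_unique => // _ [[a b]] _ <-.
  change (lebesgue_measure `]a, b] = `|s|%:E * lebesgue_measure (phi @^-1` `]a, b]))%E.
  have [sp|sn] : 0 < s \/ s < 0 by apply/orP; rewrite orbC -neq_lt.
    rewrite (_ : phi @^-1` `]a, b] = `](a - t) / s, (b - t) / s]%classic); last first.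
      apply/seteqP; split => x /=; rewrite !in_itv/= ltr_pdivrMr// ler_pdivlMr//;
      by rewrite /phi [x * s]mulrC ltrBlDr lerBrDr.
    rewrite !lebesgue_measure_itv/= !lte_fin ltr_pM2r ?invr_gt0// ltrD2r.
    case: ifPn => ab; last by rewrite mule0.
    by rewrite gtr0_norm// -!EFinB -EFinM; congr EFin; field.
  (* A negative slope swaps the endpoints, so the preimage is closed on the left instead of the
     right. *)
  rewrite (_ : phi @^-1` `]a, b] = `[(b - t) / s, (a - t) / s[%classic); last first.
    apply/seteqP; split => x /=; rewrite !in_itv/= ltr_ndivlMr// ler_ndivrMr//;
    by rewrite /phi [x * s]mulrC ltrBlDr lerBrDr andbC.
  rewrite !lebesgue_measure_itv/= !lte_fin ltr_nM2r ?invr_lt0// ltrD2r.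
  case: ifPn => ab; last by rewrite mule0.
  by rewrite ltr0_norm// -!EFinB -EFinM; congr EFin; field.
rewrite (eq_measure_integral m).
  rewrite ge0_integral_mscale//.
  by rewrite ge0_integral_pushforward.
by move=> A mA _; exact: mE.
Qed.

(** * Joint laws of independent families *)

Section joint_law.
Context {d d1 d2} {T : measurableType d} {S1 : measurableType d1}
  {S2 : measurableType d2} {R : realType} (P : probability T R).
Local Open Scope ereal_scope.

(** Both sides are finite measures in [C] that agree on rectangles, a generating family closed under
    intersection. The extra event [E] carries what happens to the later variables, so that
    independence from them survives when [X] and [Y] are combined. *)
Lemma indep_joint_law (X : {mfun T >-> S1}) (Y : {mfun T >-> S2}) (E : set T) :
  measurable E ->
  (forall A B, measurable A -> measurable B ->
     P (X @^-1` A `&` Y @^-1` B `&` E) =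
     P (X @^-1` A) * (P (Y @^-1` B) * P E)) ->
  forall C, measurable C ->
    P ([set w | C (X w, Y w)] `&` E) =
    (distribution P X \x distribution P Y) C * P E.
Proof.
move=> mE XYE C mC.
pose r : {nonneg R} := NngNum (fine_ge0 (measure_ge0 P E)).
have rE : r%:num%:E = P E by rewrite /r/= fineK// fin_num_measure.
have mXY : measurable_fun [set: T] (fun w => (X w, Y w)).
  exact: measurable_fun_pair.
pose m : {measure set (S1 * S2) -> \bar R} :=
  measure_function_pushforward__canonical__measure_function_Measure
    (mrestr P mE) mXY.
pose m' : {measure set (S1 * S2) -> \bar R} :=
  mscale r (distribution P X \x distribution P Y).
transitivity (m C); first by [].
rewrite -rE muleC.
transitivity (m' C); last by [].
pose G := [set A `*` B | A in @measurable _ S1 & B in @measurable _ S2].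
apply: (measure_unique G (fun=> setT)) => //.
- exact: measurable_prod_measurableType.
- move=> _ _ [A mA [B mB <-]] [A' mA' [B' mB' <-]].
  rewrite -setXI; exists (A `&` A'); first exact: measurableI.
  by exists (B `&` B') => //; exact: measurableI.
- by move=> n; exists setT => //; exists setT => //; rewrite setXTT.
- by apply/seteqP; split => // x _; exists 0%N.
- move=> _ [A mA [B mB <-]].
  transitivity (P (X @^-1` A `&` Y @^-1` B `&` E)); first by [].
  rewrite XYE// /m'.
  transitivity (r%:num%:E * (distribution P X \x distribution P Y) (A `*` B)); last by [].
  by rewrite product_measure1E// rE muleA muleC.
- move=> n; apply: (@le_lt_trans _ _ 1); last exact: ltry.
  have -> : m setT = P (setT `&` E) by [].
  by rewrite setTI probability_le1.
Qed.

End joint_law.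

Section partial_op.
Context {d d'} {T : measurableType d} {S : measurableType d'} {R : realType}
  (P : probability T R).
Local Open Scope ereal_scope.
Variables (op : S -> S -> S).
Hypothesis mop : measurable_fun [set: S * S] (fun z => op z.1 z.2).

Lemma measurable_op2 (X Y : {mfun T >-> S}) :
  measurable_fun [set: T] (fun w => op (X w) (Y w)).
Proof.
apply: (measurableT_comp mop (g := fun w => (X w, Y w))).
exact: measurable_fun_pair.
Qed.

Definition mfun_op2 (X Y : {mfun T >-> S}) : {mfun T >-> S} :=
  HB.pack (fun w => op (X w) (Y w))
    (isMeasurableFun.Build _ _ _ _ _ (measurable_op2 X Y)).

Variable eta : nat -> {mfun T >-> S}.

Fixpoint partial_op (k : nat) : {mfun T >-> S} :=
  if k is k'.+1 then mfun_op2 (partial_op k') (eta k'.+1) else eta 0%N.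

Variable n : nat.
Hypothesis eta_indep : forall B : nat -> set S, (forall i, measurable (B i)) ->
  P [set w | forall j, (j < n.+1)%N -> B j (eta j w)] =
  \prod_(0 <= j < n.+1) P (eta j @^-1` B j).

Let tail k (B : nat -> set S) :=
  [set w | forall j, (k < j < n.+1)%N -> B j (eta j w)].

Let measurable_tail k B : (forall i, measurable (B i)) -> measurable (tail k B).
Proof.
move=> mB.
rewrite (_ : tail k B =
    \bigcap_(j in [set j | (k < j < n.+1)%N]) (eta j @^-1` B j))//.
apply: bigcap_measurableType => j _.
by rewrite -[X in measurable X]setTI; exact: measurable_funPT.
Qed.

Let tail_step k B B' : (k < n)%N ->
  tail k (fun j => if j == k.+1 then B' else B j) =
  eta k.+1 @^-1` B' `&` tail k.+1 B.
Proof.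
move=> kn; apply/seteqP; split=> w /=.
  move=> H; split; first by have := H k.+1; rewrite eqxx ltnS leqnn ltnS kn; apply.
  move=> j /andP[kj jn]; have := H j; rewrite gtn_eqF//; apply.
  by rewrite jn (ltn_trans _ kj).
move=> [Hk H] j /andP[kj jn]; case: eqVneq => [->//|jk].
by apply: H; rewrite jn andbT ltn_neqAle eq_sym jk.
Qed.

Let prod_step k B B' : (k < n)%N ->
  \prod_(k.+1 <= j < n.+1) P (eta j @^-1` (if j == k.+1 then B' else B j)) =
  P (eta k.+1 @^-1` B') * \prod_(k.+2 <= j < n.+1) P (eta j @^-1` B j).
Proof.
move=> kn; rewrite big_ltn; last by rewrite ltnS.
rewrite eqxx; congr (_ * _); apply: eq_big_nat => j /andP[kj _].
by rewrite gtn_eqF.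
Qed.

Let prod_setT k : \prod_(k <= j < n.+1) P (eta j @^-1` setT) = 1.
Proof. by apply: big1 => j _; rewrite preimage_setT probability_setT. Qed.

(** The invariant is independence of a partial result from all later variables jointly; independence
    from the next one alone would not propagate through the induction. *)
Lemma partial_op_indep_tail k A B : (k <= n)%N -> measurable A ->
  (forall i, measurable (B i)) ->
  P (partial_op k @^-1` A `&` tail k B) =
  P (partial_op k @^-1` A) * \prod_(k.+1 <= j < n.+1) P (eta j @^-1` B j).
Proof.
elim: k A B => [|k IH] A B kn mA mB.
  pose B0 j := if j == 0%N then A else B j.
  have -> : partial_op 0 @^-1` A `&` tail 0 B =
      [set w | forall j, (j < n.+1)%N -> B0 j (eta j w)].
    apply/seteqP; split=> w /=.
      by move=> [Aw H] [|j] jn//=; apply: H.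
    by move=> H; split; [exact: (H 0%N)|case=> // j jn; exact: (H j.+1)].
  rewrite eta_indep; last by rewrite /B0 => -[|j] /=.
  rewrite big_ltn//=; congr (_ * _); apply: eq_big_nat => -[|j]//.
have mif B1 : measurable B1 -> forall i, measurable (if i == k.+1 then B1 else B i).
  by move=> mB1 i; case: ifPn.
(* The induction hypothesis, with sure events for the partial result and for the next variable,
   isolates the tail. *)
have PE : P (tail k.+1 B) = \prod_(k.+2 <= j < n.+1) P (eta j @^-1` B j).
  have := IH setT (fun j => if j == k.+1 then setT else B j) (ltnW kn) measurableT
    (mif _ measurableT).
  by rewrite tail_step// prod_step// !preimage_setT !setTI probability_setT !mul1e.
(* Used twice, with [E] the tail event and with [E] the whole space; both uses produce the same
   product-measure factor. *)
have J E : measurable E -> (forall A0 B0, measurable A0 -> measurable B0 ->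
     P (partial_op k @^-1` A0 `&` eta k.+1 @^-1` B0 `&` E) =
     P (partial_op k @^-1` A0) * (P (eta k.+1 @^-1` B0) * P E)) ->
   P (partial_op k.+1 @^-1` A `&` E) =
   (distribution P (partial_op k) \x distribution P (eta k.+1))
     ((fun z => op z.1 z.2) @^-1` A) * P E.
  move=> mE HE.
  have mC : measurable ((fun z => op z.1 z.2) @^-1` A).
    by rewrite -[X in measurable X]setTI; exact: mop.
    by have := indep_joint_law mE HE mC.
rewrite J//; last first.
- move=> A0 B0 mA0 mB0; rewrite -setIA -tail_step// (IH _ _ (ltnW kn) mA0 (mif _ mB0)).
  by rewrite prod_step// PE.
- exact: measurable_tail.
rewrite PE; congr (_ * _).
(* The sure event identifies the product-measure factor with the marginal probability of the new
   partial result. *)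
rewrite -[partial_op k.+1 @^-1` A]setIT J//; first by rewrite probability_setT mule1.
move=> A0 B0 mA0 mB0; rewrite setIT probability_setT mule1.
have := IH A0 (fun j => if j == k.+1 then B0 else setT) (ltnW kn) mA0.
rewrite tail_step// prod_step// prod_setT mule1.
rewrite (_ : tail k.+1 _ = setT) ?setIT; last by apply/seteqP; split.
by apply => i; case: ifPn.
Qed.

Lemma partial_op_joint_law k C : (k < n)%N -> measurable C ->
  P [set w | C (partial_op k w, eta k.+1 w)] =
  (distribution P (partial_op k) \x distribution P (eta k.+1)) C.
Proof.
move=> kn mC.
have := @indep_joint_law _ _ _ _ _ _ _ P (partial_op k) (eta k.+1) setT measurableT _ C mC.
rewrite setIT probability_setT mule1; apply => A0 B0 mA0 mB0.
rewrite setIT mule1.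
have := @partial_op_indep_tail k A0 (fun j => if j == k.+1 then B0 else setT)
  (ltnW kn) mA0.
rewrite tail_step// prod_step// prod_setT mule1.
rewrite (_ : tail k.+1 _ = setT) ?setIT; last by apply/seteqP; split.
by apply => i; case: ifPn.
Qed.

End partial_op.

(** * Density of a function of two independent variables *)

Section op_density.
Context {d} {T : measurableType d} {R : realType} (P : probability T R).
Local Open Scope ereal_scope.
Local Notation TR := (measurableTypeR R).
Local Notation mu := (@lebesgue_measure R).
Variables (op : TR -> TR -> TR) (X Y : {mfun T >-> TR}).
Variables (g : TR -> R) (k : TR -> TR -> R).
Hypothesis mop : measurable_fun [set: TR * TR] (fun z => op z.1 z.2).
Hypothesis mg : measurable_fun [set: TR] g.
Hypothesis g0 : forall y, (0 <= g y)%R.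
Hypothesis mk : measurable_fun [set: TR * TR] (fun z => k z.1 z.2).
Hypothesis k0 : forall u y, (0 <= k u y)%R.
Hypothesis gE : forall A, measurable A ->
  P (Y @^-1` A) = \int[mu]_(y in A) (g y)%:E.
Hypothesis kE : forall y, g y != 0%R -> forall A, measurable A ->
  P (X @^-1` (op^~ y @^-1` A)) = \int[mu]_(u in A) (k u y)%:E.
Hypothesis XYE : forall C, measurable C ->
  P [set w | C (X w, Y w)] = (distribution P X \x distribution P Y) C.

(** Here [k u y] is the density at [u] of [op(X, y)] with [y] frozen. It is required only where
    [g y] is nonzero, since for multiplication [y = 0] collapses [X] to a point mass. *)
Lemma op_density A : measurable A ->
  P [set w | A (op (X w) (Y w))] =
  \int[mu]_(u in A) \int[mu]_y (k u y * g y)%:E.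
Proof.
move=> mA; pose C : set (TR * TR) := (fun z => op z.1 z.2) @^-1` A.
have mC : measurable C by rewrite -[X in measurable X]setTI; exact: mop.
transitivity ((distribution P X \x distribution P Y) C); first exact: XYE.
(* The product measure is recomputed with [y] as the outer variable, so that its sections are events
   about [X] at fixed [y]. *)
rewrite (@product_measure_unique _ _ _ _ _ (distribution P X) (distribution P Y)
  (distribution P X \x^ distribution P Y)%E)//; last first.
  by move=> A1 B1 mA1 mB1; exact: product_measure2E.
rewrite [LHS](_ : _ = \int[distribution P Y]_y (distribution P X \o ysection C) y)//.
rewrite (ge0_integral_density (mu := mu) mg)//; last first.
  exact: measurable_fun_ysection.
transitivity (\int[mu]_y \int[mu]_u ((\1_A u) * (k u y * g y))%:E).
  apply: eq_integral => y _.
  have [gy0|gy0] := eqVneq (g y) 0%R.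
    rewrite gy0 mule0; under eq_integral do rewrite !mulr0.
    by rewrite integral0.
  rewrite [X in X * _](_ : _ = P (X @^-1` (op^~ y @^-1` A))); last first.
    congr (P _); apply/seteqP; split=> w /=; rewrite /C/= /ysection/= ?inE//=.
  rewrite kE// integral_mkcond.
  rewrite muleC -ge0_integralZl//=.
  - apply: eq_integral => u _; rewrite patchE indicE.
    by case: ifPn => uA; rewrite ?mul1r ?mul0r ?mule0// -EFinM mulrC.
  - apply/(measurable_restrictT (fun u => (k u y)%:E)) => //.
    apply/measurable_EFinP/measurable_funTS.
    exact: measurableT_comp mk (measurable_pair2 y).
  - by move=> u _; apply: erestrict_ge0 => ? _; rewrite lee_fin.
  - by rewrite lee_fin.
rewrite (fubini_tonelli (fun z : TR * TR => ((\1_A z.2) * (k z.2 z.1 * g z.1))%:E))/=.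
- rewrite [RHS]integral_mkcond; apply: eq_integral => u _.
  rewrite patchE; case: ifPn => uA.
    by apply: eq_integral => y _; rewrite indicE uA mul1r.
  by rewrite integral0_eq// => y _; rewrite indicE (negbTE uA) mul0r.
- apply/measurable_EFinP; apply: measurable_funM.
    by apply: (measurableT_comp (measurable_indic _)) => //; exact: measurable_snd.
  apply: measurable_funM; last by apply: (measurableT_comp mg); exact: measurable_fst.
  apply: (measurableT_comp mk (g := fun z : TR * TR => (z.2, z.1))).
  exact: measurable_swap.
- by move=> z; rewrite lee_fin !mulr_ge0.
Qed.

End op_density.

(** * Sparsity shape parameter from power bounds *)

Section sparsity.
Context {R : realType}.
Implicit Types (p q : R -> R) (a v : R).

Lemma pos_powRD (x r s : R) : 0 < x -> x `^ (r + s) = x `^ r * x `^ s.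
Proof. by move=> x0; rewrite powRD// (gt_eqF x0) implybT. Qed.

Lemma powR_divB1 (x y z : R) : 0 < x -> y / x `^ (z - 1) = x * y / x `^ z.
Proof.
move=> x0; have -> : x `^ (z - 1) = x `^ z / x.
  by rewrite pos_powRD// powR_inv1 ?ltW.
by rewrite invfM invrK mulrA mulrAC [y * x]mulrC.
Qed.

(** For [z > v] the lower bound makes the ratio at least [c x^(v - z)], which is unbounded at 0; for
    [z < v] an upper bound with an exponent between [z] and [v] sends it to 0. *)
Lemma sparsity_shape_bounds q v : 0 < v ->
  (forall x, 0 < x -> 0 <= q x) ->
  (forall z, 0 <= z < v -> exists C, forall x, 0 < x <= 1 -> x * q x <= C * x `^ z) ->
  (exists2 c, 0 < c & forall x, 0 < x <= 1 -> c * x `^ v <= x * q x) ->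
  sparsity_shape q = v%:E.
Proof.
move=> v0 q0 qub [c c0 qlb]; apply/eqP; rewrite eq_le; apply/andP; split.
  apply: ge_ereal_sup => _ [z [kappa zk] <-]; rewrite lee_fin leNgt; apply/negP => vz.
  have k1 : \forall x \near 0^'+, q x / x `^ (z - 1) <= `|kappa| + 1.
    move/cvgrPdist_le : zk => /(_ _ ltr01); apply: filterS => x.
    by rewrite ler_distlC => /andP[_] h; rewrite (le_trans h)// lerD2r ler_norm.
  have zv : 0 < z - v by rewrite subr_gt0.
  have c1 : 0 < c / (`|kappa| + 2) by rewrite divr_gt0// ltr_wpDl.
  have k2 : \forall x \near 0^'+, x `^ (z - v) < c / (`|kappa| + 2).
    have /cvgr_lt := powR_cvg0 zv; exact.
  near (0:R)^'+ => x.
  have x0 : 0 < x by near: x; exact: nbhs_right_gt.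
  have x1 : x <= 1 by near: x; exact: nbhs_right_le.
  have h1 : q x / x `^ (z - 1) <= `|kappa| + 1 by near: x.
  have h2 : x `^ (z - v) < c / (`|kappa| + 2) by near: x.
  move: h1; rewrite powR_divB1// ler_pdivrMr ?powR_gt0// => h1.
  have x01 : 0 < x <= 1 by rewrite x0.
  have := le_trans (qlb x x01) h1.
  have -> : x `^ z = x `^ (z - v) * x `^ v by rewrite -pos_powRD// subrK.
  rewrite mulrA ler_pM2r ?powR_gt0//; apply/negP; rewrite -ltNge.
  move: h2; rewrite ltr_pdivlMr ?ltr_wpDl// => h2; apply: le_lt_trans h2.
  by rewrite mulrC ler_wpM2l ?powR_ge0// lerD2l ler1n.
apply/lee_addgt0Pr => e e0.
rewrite -leeBlDr// -EFinB; apply: ereal_sup_ubound; exists (v - e) => //; exists 0.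
set z := v - e.
have zv : z < v by rewrite /z ltrBlDr ltrDl.
(* The midpoint gives [z < z' < v]; the maximum with 0 is taken because [v - e] may be negative
   while upper bounds are supplied for nonnegative exponents only. *)
pose z' := Num.max 0 ((z + v) / 2).
have z'0 : 0 <= z' by rewrite le_max lexx.
have z'v : z' < v by rewrite gt_max v0/= midf_lt.
have zz' : z < z' by rewrite lt_max [X in _ || X]midf_lt// orbT.
have [|C qC] := qub z'; first by rewrite z'0 z'v.
have : C * x `^ (z' - z) @[x --> 0^'+] --> 0.
  have z'z0 : 0 < z' - z by rewrite subr_gt0.
  by rewrite -[X in _ --> X](mulr0 C); apply: cvgM; [exact: cvg_cst|exact: powR_cvg0].
apply: squeeze_cvgr; last exact: cvg_cst.
near=> x.
have x0 : 0 < x by near: x; exact: nbhs_right_gt.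
have x1 : x <= 1 by near: x; exact: nbhs_right_le.
apply/andP; split; first by rewrite divr_ge0 ?q0// powR_ge0.
rewrite powR_divB1// ler_pdivrMr ?powR_gt0// (le_trans (qC x _)) ?x0//.
by rewrite -mulrA -pos_powRD// subrK.
Unshelve. all: by end_near. Qed.

(** On the compact interval from [x / 2] to [2 x] both densities are integrable with equal integrals
    over subsets, hence equal almost everywhere; a difference at [x] would persist on a ball, which
    has positive measure. *)
Lemma continuous_density_unique d (T : measurableType d) (P : probability T R)
  (X : T -> R) p q : has_density P X p -> has_density P X q ->
  continuous_on_pos p -> continuous_on_pos q -> forall x, 0 < x -> p x = q x.
Proof.
move=> pX qX pc qc x x0; apply/eqP; apply: contraT => pq.
pose I : set R := `[x / 2, x * 2]%classic.
have Ipos y : I y -> 0 < y.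
  by rewrite /I/= in_itv/= => /andP[+ _]; apply: lt_le_trans; rewrite divr_gt0.
have mI : measurable (I : set (measurableTypeR R)) by exact: measurable_itv.
have cI (f : R -> R) : continuous_on_pos f -> {within I, continuous f}.
  move=> fc; apply: continuous_in_subspaceT => y; rewrite inE => /Ipos; exact: fc.
have iI (f : R -> R) : continuous_on_pos f ->
    lebesgue_measure.-integrable I (EFin \o f).
  move=> fc; apply: continuous_compact_integrable; last exact: cI.
  exact: segment_compact.
have : ae_eq lebesgue_measure I (EFin \o p) (EFin \o q).
  apply: integral_ae_eq => //; [exact: iI|by have /measurable_int := iI _ qc|].
  by move=> E EI mE; rewrite -pX// -qX.
case=> N [mN N0 HN].
have pq0 : p y - q y @[y --> x] --> p x - q x by apply: cvgB; [exact: pc|exact: qc].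
have pqx : p x - q x != 0 by rewrite subr_eq0.
have : \forall y \near x, p y != q y /\ I y.
  near=> y; split.
    by rewrite -subr_eq0; near: y; exact: cvgr_neq0 pqx.
  suff : y \in `]x / 2, x * 2[ by exact: subset_itv_oo_cc.
  near: y; apply: near_in_itvoo.
  by rewrite in_itv/= ltr_pdivrMr// ltr_pMr// ltr1n.
case/nbhs_ballP => e /= e0 He.
suff : (lebesgue_measure (ball x e) <= 0)%E.
  by rewrite lebesgue_measure_ball ?(ltW e0)// leNgt lte_fin mulrn_wgt0.
rewrite -[leRHS]N0; apply: le_measure; rewrite ?inE//; first exact: measurable_ball.
move=> y /He[pqy Iy]; apply: HN => /= /(_ Iy)[pqE].
by move: pqy; rewrite pqE eqxx.
Unshelve. all: by end_near. Qed.

Lemma sparsity_of_rv_is_bounds d (T : measurableType d) (P : probability T R)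
  (X : T -> R) p v : has_density P X p -> continuous_on_pos p -> 0 < v ->
  (forall x, 0 < x -> 0 <= p x) ->
  (forall z, 0 <= z < v -> exists C, forall x, 0 < x <= 1 -> x * p x <= C * x `^ z) ->
  (exists2 c, 0 < c & forall x, 0 < x <= 1 -> c * x `^ v <= x * p x) ->
  sparsity_of_rv_is P X v%:E.
Proof.
move=> pX pc v0 p0 pub [c c0 plb]; split; first by exists p.
move=> q qX qc; have pq := continuous_density_unique pX qX pc qc.
apply: sparsity_shape_bounds => //.
- by move=> x x0; rewrite -pq// p0.
- move=> z /pub[C HC]; exists C => x /[dup] /andP[x0 _] /HC.
  by rewrite pq.
- by exists c => // x /[dup] /andP[x0 _] /plb; rewrite pq.
Qed.

End sparsity.

(** * Integrability of powers and of the Beta kernel *)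

Section power_integrals.
Context {R : realType}.
Local Notation TR := (measurableTypeR R).
Local Notation mu := (@lebesgue_measure R).
Implicit Types (a b r x : R).

Lemma continuous_powR r x : 0 < x -> {for x, continuous (fun t : R => t `^ r)}.
Proof.
move=> x0; apply: differentiable_continuous; apply/derivable1_diffP.
by apply: derivable_powR; rewrite in_itv/= x0.
Qed.

(** A power is monotone one way or the other; adding both end values gives a majorant that does not
    depend on the sign of [r]. *)
Lemma powR_le_ends r u v x : 0 < u -> u <= x <= v -> x `^ r <= u `^ r + v `^ r.
Proof.
move=> u0 /andP[ux xv]; have x0 := lt_le_trans u0 ux.
have [r0|r0] := leP 0 r.
  rewrite ler_wpDl ?powR_ge0// ge0_ler_powR ?nnegrE// ?ltW//.
  exact: lt_le_trans xv.
rewrite ler_wpDr ?powR_ge0// -(opprK r) !(powRN _ (- r)).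
by rewrite lef_pV2 ?posrE ?powR_gt0// ge0_ler_powR ?nnegrE ?oppr_ge0 ?(ltW r0) ?(ltW x0) ?(ltW u0).
Qed.

Lemma integrable_powR a : 0 < a ->
  mu.-integrable `]0, 1[ (fun t : TR => (t `^ (a - 1))%:E).
Proof.
move=> a0.
have mp : measurable_fun [set: TR] (fun t : TR => t `^ (a - 1)) by exact: measurable_powR.
apply/integrableP; split; first exact/measurable_EFinP/measurable_funTS.
under eq_integral do rewrite gee0_abs ?lee_fin ?powR_ge0//.
(* Away from 0 the primitive [x^a] is available and bounds each integral by 1; these intervals then
   exhaust the unit interval. The shift by 2 makes the left end strictly less than 1. *)
pose F n := (`[n.+2%:R^-1, 1]%classic : set TR).
have F0 n x : F n x -> 0 < x.
  by rewrite /F/= in_itv/= => /andP[+ _]; apply: lt_le_trans; rewrite invr_gt0.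
have Fn n : (\int[mu]_(x in F n) (a * x `^ (a - 1))%:E <= 1)%E.
  rewrite (@continuous_FTC2 _ (fun x => a * x `^ (a - 1)) (fun t => t `^ a)).
  - by rewrite powR1 -EFinB lee_fin gerBl powR_ge0.
  - by rewrite invf_lt1// ltr1n.
  - apply: continuous_in_subspaceT => x; rewrite inE => /F0 x0.
    apply: cvgM; [exact: cvg_cst|exact: continuous_powR].
  - split.
    + move=> x; rewrite in_itv/= => /andP[x0 _]; apply: derivable_powR.
      by rewrite in_itv/= andbT (lt_trans _ x0).
    + by apply: cvg_at_right_filter; apply: continuous_powR.
    + by apply: cvg_at_left_filter; apply: continuous_powR.
  - move=> x; rewrite in_itv/= => /andP[x0 _]; apply: powR_derive1.
    by rewrite in_itv/= andbT (lt_trans _ x0).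
have Fa : (\int[mu]_(x in \bigcup_n F n) (a * x `^ (a - 1))%:E <= 1)%E.
  have ndF : nondecreasing_seq F.
    move=> m n mn; apply/subsetPset => x; rewrite /F/= !in_itv/= => /andP[+ ->].
    by rewrite andbT; apply: le_trans; rewrite lef_pV2 ?posrE// ler_nat.
  have c : (\int[mu]_(x in F i) (a * x `^ (a - 1))%:E)%E @[i --> \oo] -->
      (\int[mu]_(x in \bigcup_n F n) (a * x `^ (a - 1))%:E)%E.
    apply: ge0_nondecreasing_set_cvg_integral => //.
    - by move=> i; exact: measurable_itv.
    - move=> i; apply/measurable_EFinP/measurable_funTS.
      by apply: measurable_funM => //; exact: mp.
    - by move=> i x _; rewrite lee_fin mulr_ge0 ?powR_ge0// ltW.
  rewrite -(cvg_lim _ c)//; apply: lime_le; first by apply/cvg_ex; eexists; exact: c.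
  by apply: nearW => n; exact: Fn.
apply: (@le_lt_trans _ _ (a^-1)%:E); last exact: ltry.
rewrite -(@lee_pmul2l _ a%:E)// ?fin_numE// -EFinM divff ?gt_eqF//.
rewrite -ge0_integralZl//; last 3 first.
  - exact/measurable_EFinP/measurable_funTS.
  - by move=> x _; rewrite lee_fin powR_ge0.
  - by rewrite lee_fin ltW.
apply: le_trans Fa.
under eq_integral do rewrite -EFinM.
apply: ge0_subset_integral => //.
- by apply: bigcup_measurable => i _; exact: measurable_itv.
- apply/measurable_EFinP/measurable_funTS.
  by apply: measurable_funM => //; exact: mp.
- by move=> x _; rewrite lee_fin mulr_ge0 ?powR_ge0// ltW.
- move=> x; rewrite /= in_itv/= => /andP[x0 x1].
  have [n _ Hn] := near_infty_natSinv_lt (PosNum x0).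
  exists n => //; rewrite /F/= in_itv/= (ltW x1) andbT ltW//.
  apply: le_lt_trans (Hn n _) => //=.
  by rewrite lef_pV2 ?posrE// ler_nat.
Qed.

(** A vanishing integral would force [f] to be 0 almost everywhere on [D], so [D] would be null. *)
Lemma Rintegral_gt0 (D : set TR) (f : TR -> R) : measurable D ->
  (0 < mu D)%E -> mu.-integrable D (EFin \o f) -> (forall x, D x -> 0 < f x) ->
  0 < \int[mu]_(x in D) f x.
Proof.
move=> mD D0 fi f0.
rewrite lt_neqAle Rintegral_ge0 ?andbT; last by move=> x /f0/ltW.
apply/eqP => If; have mf := measurable_int _ fi.
have : (\int[mu]_(x in D) `|(EFin \o f) x| = 0)%E.
  rewrite (eq_integral (EFin \o f)).
    by rewrite -[LHS]fineK ?integrable_fin_num// [fine _](esym If).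
  by move=> x; rewrite inE => /f0 fx; rewrite gee0_abs// lee_fin ltW.
move/(ae_eq_integral_abs _ mD mf) => [N [mN N0 HN]].
suff : (mu D <= 0)%E by rewrite leNgt D0.
rewrite -N0; apply: le_measure; rewrite ?inE// => x Dx; apply: HN => /=.
by move=> /(_ Dx)[fx0]; have := f0 _ Dx; rewrite fx0 ltxx.
Qed.

Lemma integrable_beta a b : 0 < a -> 0 < b ->
  mu.-integrable `]0, 1[ (fun t : TR => ((1 - t) `^ (a - 1) * t `^ (b - 1))%:E).
Proof.
move=> a0 b0.
have mp r : measurable_fun [set: TR] (fun t : TR => t `^ r) by exact: measurable_powR.
have m1 : measurable_fun [set: TR] (fun t : TR => (1 - t : TR)).
  by apply: measurable_funB.
have mq r : measurable_fun [set: TR] (fun t : TR => (1 - t) `^ r).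
  exact: (measurableT_comp (mp r) m1).
have iq : mu.-integrable `]0, 1[ (fun t : TR => ((1 - t) `^ (a - 1))%:E).
  apply/integrableP; split; first exact/measurable_EFinP/measurable_funTS.
  have /integrableP[_] := integrable_powR a0.
  under eq_integral do rewrite gee0_abs ?lee_fin ?powR_ge0//.
  under [X in _ -> (X < _)%E]eq_integral do rewrite gee0_abs ?lee_fin ?powR_ge0//.
  suff -> : (\int[mu]_(t in `]0%R, 1%R[) ((1 - t) `^ (a - 1))%:E =
    \int[mu]_(t in `]0%R, 1%R[) (t `^ (a - 1))%:E)%E by [].
  rewrite [RHS]integral_mkcond [RHS](@ge0_integral_affine _ (-1) 1).
  - rewrite normrN1 mul1e [LHS]integral_mkcond; apply: eq_integral => x _.
    have e : -1 * x + 1 = 1 - x by ring.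
    rewrite !patchE e.
    have -> // : (1 - x \in `]0, 1[%classic) = (x \in `]0, 1[%classic).
    rewrite !mem_setE !in_itv/=; lra.
  - by rewrite oppr_eq0 oner_eq0.
  - apply/(measurable_restrictT (fun t : R => (t `^ (a - 1))%:E)) => //.
    exact/measurable_EFinP/measurable_funTS.
  - by move=> x; apply: erestrict_ge0 => y _; rewrite lee_fin powR_ge0.
(* Cutting at 1/2 separates the two singularities: on each half one factor lies between the values
   of its power at 1/2 and at 1, and the other is integrable alone. *)
pose Ca := 1 + 2^-1 `^ (a - 1); pose Cb := 1 + 2^-1 `^ (b - 1).
have h0 (r : R) : 0 <= 2^-1 `^ r by exact: powR_ge0.
have hC (r x : R) : 2^-1 <= x <= 1 -> x `^ r <= 1 + 2^-1 `^ r.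
  by move=> xI; have := @powR_le_ends r (2^-1) 1 x; rewrite powR1 addrC; apply.
apply: (@le_integrable _ _ _ _ _ _ _
  (fun t : TR => (Ca * t `^ (b - 1))%:E + (Cb * (1 - t) `^ (a - 1))%:E)%E) => //.
- apply/measurable_EFinP/measurable_funTS; apply: measurable_funM; [exact: mq|exact: mp].
- move=> t; rewrite /= in_itv/= => /andP[t0 t1]; rewrite lee_fin.
  rewrite !ger0_norm ?addr_ge0 ?mulr_ge0 ?addr_ge0 ?powR_ge0//.
  have [th|th] := leP t 2^-1.
    rewrite ler_wpDr ?mulr_ge0 ?addr_ge0 ?powR_ge0//.
    by rewrite ler_wpM2r ?powR_ge0// hC//; lra.
  rewrite ler_wpDl ?mulr_ge0 ?addr_ge0 ?powR_ge0// mulrC.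
  by rewrite ler_wpM2r ?powR_ge0// hC//; lra.
- apply: integrableD => //.
  + have := @integrableZl _ _ _ mu `]0, 1[%classic (measurable_itv _) Ca _ (integrable_powR b0).
    exact.
  + have := @integrableZl _ _ _ mu `]0, 1[%classic (measurable_itv _) Cb _ iq.
    exact.
Qed.

End power_integrals.

(** * Additive and multiplicative convolutions *)

Section pos_density.
Context {R : realType}.
Local Notation TR := (measurableTypeR R).
Local Notation mu := (@lebesgue_measure R).
Implicit Types (f g : R -> R) (a b : R).

(** Vanishing on the nonpositive half-line allows convolutions to be integrals over the whole
    line. *)
Definition pos_density f :=
  [/\ forall x, x <= 0 -> f x = 0, forall x, 0 <= f x & continuous_on_pos f].

(* Two-sided power bounds at 0+ are stated for x f(x), the density of the law
   with respect to the multiplicative Haar measure dx/x. *)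
Definition upper_order f a := exists C, forall x, 0 < x -> x * f x <= C * x `^ a.

(** The bound is local because [x f(x)] may decay at infinity, as it does for gamma-gamma densities.
    Every [b] is allowed since the window used for products evaluates a factor beyond the point
    considered, up to twice as far. *)
Definition lower_order f a := forall b, 0 < b ->
  exists2 c, 0 < c & forall x, 0 < x <= b -> c * x `^ a <= x * f x.

Lemma measurable_pos_density f : pos_density f -> measurable_fun [set: TR] f.
Proof.
move=> [f0 _ fc]; rewrite (_ : f = f \_ `]0, +oo[%classic); last first.
  apply/funext => x; rewrite patchE mem_setE in_itv/= andbT.
  by case: ltP => // /f0.
apply/(measurable_restrictT f) => //.
apply: open_continuous_measurable_fun; first exact: interval_open.
by move=> x; rewrite inE/= in_itv/= andbT => /fc.
Qed.

Lemma upper_orderB1 f a : upper_order f a ->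
  exists2 C, 0 <= C & forall x, 0 < x -> f x <= C * x `^ (a - 1).
Proof.
move=> [C fC]; exists (Num.max 0 C); first by rewrite le_max lexx.
move=> x x0; have xa : x * x `^ (a - 1) = x `^ a.
  by rewrite -{1}(powRr1 (ltW x0)) -pos_powRD// addrC subrK.
rewrite -(ler_pM2l x0) mulrCA xa (le_trans (fC _ x0))// ler_wpM2r ?powR_ge0//.
by rewrite le_max lexx orbT.
Qed.

Lemma lower_orderB1 f a : lower_order f a -> forall b, 0 < b ->
  exists2 c, 0 < c & forall x, 0 < x <= b -> c * x `^ (a - 1) <= f x.
Proof.
move=> fl b /fl[c c0 fc]; exists c => // x /[dup] /andP[x0 _] /fc; apply: contraTT.
rewrite -!ltNge -(ltr_pM2l x0) mulrCA => /lt_le_trans; apply.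
by rewrite -{1}(powRr1 (ltW x0)) -pos_powRD// addrC subrK.
Qed.

Lemma continuous_near f g x : (\forall y \near x, f y = g y) ->
  {for x, continuous g} -> {for x, continuous f}.
Proof.
move=> fg gc; rewrite /prop_for /continuous_at.
have -> : f x = g x by exact: (nbhs_singleton fg).
by apply: cvg_trans gc; apply: near_eq_cvg; apply: filterS fg.
Qed.

Section sum.
Variables (f g : R -> R) (a b : R).
Hypotheses (fP : pos_density f) (gP : pos_density g) (a0 : 0 < a) (b0 : 0 < b).

(* After y = x t, the convolution at x is x times the integral of K x. *)
Let K x t := f (x * (1 - t)) * g (x * t).
Let h x := if 0 < x then x * \int[mu]_(t in `]0, 1[) K x t else 0.
Let beta t := (1 - t) `^ (a - 1) * t `^ (b - 1).
Let B := \int[mu]_(t in `]0, 1[) beta t.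

Let mf := measurable_pos_density fP.
Let mg := measurable_pos_density gP.

Let K0 x t : 0 <= K x t.
Proof. by case: fP gP => _ f0 _ [_ g0 _]; rewrite mulr_ge0. Qed.

Let mK x : measurable_fun [set: TR] (K x).
Proof.
apply: measurable_funM.
- apply: (measurableT_comp mf); apply: measurable_funM => //.
  exact: measurable_funB.
- by apply: (measurableT_comp mg); exact: measurable_funM.
Qed.

Let powR_scale x t : 0 < x -> 0 < t < 1 ->
  (x * (1 - t)) `^ (a - 1) * (x * t) `^ (b - 1) =
  x `^ (a - 1) * x `^ (b - 1) * beta t.
Proof.
move=> x0 /andP[t0 t1].
rewrite !powRM ?ltW// ?subr_gt0//.
by rewrite /beta mulrACA.
Qed.

Let x_powRB1 x : 0 < x ->
  x * (x * (x `^ (a - 1) * x `^ (b - 1))) = x `^ (a + b).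
Proof.
move=> x0; rewrite mulrA -expr2 -powR_mulrn ?ltW// -!pos_powRD//.
by congr (_ `^ _); lra.
Qed.

Hypotheses (fu : upper_order f a) (gu : upper_order g b).

Let Kub : exists2 C, 0 <= C &
  forall x t, 0 < x -> 0 < t < 1 -> K x t <= C * (x `^ (a - 1) * x `^ (b - 1) * beta t).
Proof.
have [C C0 fC] := upper_orderB1 fu; have [C' C'0 gC] := upper_orderB1 gu.
exists (C * C'); first exact: mulr_ge0.
move=> x t x0 /[dup] t01 /andP[t0 t1]; rewrite -powR_scale// mulrACA.
case: fP gP => _ f0 _ [_ g0 _].
by rewrite ler_pM// ?fC ?gC ?mulr_gt0// subr_gt0.
Qed.

Let ibeta : mu.-integrable `]0, 1[ (EFin \o beta).
Proof. exact: integrable_beta. Qed.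

Let ibetaZ C : mu.-integrable `]0, 1[ (fun t : TR => (C * beta t)%:E).
Proof. exact: (@integrableZl _ _ _ mu `]0, 1[%classic (measurable_itv _) C _ ibeta). Qed.

Let beta0 t : 0 <= beta t.
Proof. by rewrite mulr_ge0 ?powR_ge0. Qed.

Let iK x : 0 < x -> mu.-integrable `]0, 1[ (EFin \o K x).
Proof.
move=> x0; have [C C0 KC] := Kub.
apply: le_integrable (ibetaZ (C * (x `^ (a - 1) * x `^ (b - 1)))) => //.
- by apply/measurable_EFinP/measurable_funTS; exact: mK.
- move=> t; rewrite /= in_itv/= => t01; rewrite lee_fin !ger0_norm//.
    by rewrite (le_trans (KC _ _ x0 t01))// !mulrA.
  by rewrite !mulr_ge0 ?powR_ge0.
Qed.

Let hc : continuous_on_pos h.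
Proof.
move=> x x0.
apply: (@continuous_near _ (fun y => y * \int[mu]_(t in `]0, 1[) K y t)).
  near=> y; rewrite /h ifT//; near: y; exact: lt_nbhsr.
apply: cvgM; first exact: cvg_id.
have [C C0 KC] := Kub.
pose u := x / 2; pose v := x * 2.
(* For [y] between [u] and [v] the powers of [y] are bounded by their end values, so [M] times the
   Beta kernel dominates [K y] uniformly. *)
pose M := C * ((u `^ (a - 1) + v `^ (a - 1)) * (u `^ (b - 1) + v `^ (b - 1))).
have u0 : 0 < u by rewrite divr_gt0.
have Ipos y : y \in `]u, v[ -> 0 < y.
  by rewrite in_itv/= => /andP[+ _]; apply: lt_trans.
apply: (@continuity_under_integral R _ TR mu K `]0, 1[ _ u v _ _ (fun t => M * beta t)).
- exact: measurable_itv.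
- by move=> y /Ipos; exact: iK.
- apply: aeW => t /=; rewrite in_itv/= => /andP[t0 t1] y; rewrite inE => /Ipos y0.
  case: fP gP => _ _ fc [_ _ gc].
  have dilate (p : R -> R) (r : R) : 0 < r -> continuous_on_pos p ->
      {for y, continuous (p \o ( *%R^~ r))}.
    move=> r0 pc; apply: continuous_comp; first exact: mulrr_continuous.
    by apply: pc; rewrite mulr_gt0.
  have t10 : 0 < 1 - t by rewrite subr_gt0.
  by apply: cvgM; [exact: (dilate f _ t10)|exact: (dilate g _ t0)].
- exact: ibetaZ.
- move=> y /[dup] /Ipos y0; rewrite /= in_itv/= => /andP[/ltW uy /ltW yv].
  apply: aeW => t /=; rewrite in_itv/= => t01.
  rewrite ger0_norm// (le_trans (KC _ _ y0 t01))// mulrA ler_wpM2r// ler_wpM2l//.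
  by rewrite ler_pM ?powR_ge0// powR_le_ends// uy yv.
- by rewrite inE/= in_itv/=; apply/andP; split; rewrite /u /v; lra.
Unshelve. all: by end_near. Qed.

Lemma sum_density : exists h, [/\ pos_density h,
  forall x, (\int[mu]_y (f (x - y) * g y)%:E)%E = (h x)%:E,
  upper_order h (a + b) &
  lower_order f a -> lower_order g b -> lower_order h (a + b)].
Proof.
exists h; split.
- split; last exact: hc.
  + by move=> x x0; rewrite /h ltNge x0.
  + move=> x; rewrite /h; case: ifPn => // x0; rewrite mulr_ge0 ?(ltW x0)//.
    by apply: Rintegral_ge0 => t _; exact: K0.
- case: (fP) (gP) => fN f0 fc [gN g0 gc].
  move=> x; rewrite /h; case: ltP => [x0|x0]; last first.
    rewrite integral0_eq// => y _; have [y0|y0] := leP y 0; first by rewrite gN// mulr0.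
    by rewrite fN ?mul0r//; lra.
  rewrite (@ge0_integral_affine _ x 0) ?gt_eqF//; last 2 first.
  + apply/measurable_EFinP; apply: measurable_funM; last exact: mg.
    by apply: (measurableT_comp mf); exact: measurable_funB.
  + by move=> y; rewrite lee_fin mulr_ge0.
  rewrite gtr0_norm// EFinM; congr (_ * _)%E.
  rewrite -[RHS]/((fine _)%:E) fineK; last first.
    by apply: integrable_fin_num (iK x0) => //; exact: measurable_itv.
  rewrite [RHS]integral_mkcond; apply: eq_integral => t _.
  rewrite patchE mem_setE in_itv/= addr0.
  have -> : x - x * t = x * (1 - t) by ring.
  (* Outside the unit interval one of the two arguments [x t] and [x (1 - t)] is nonpositive, so the
     integrand vanishes. *)
  case: ltP => t0/=; last by rewrite gN ?mulr0// pmulr_rle0.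
  case: ltP => t1//; rewrite fN ?mul0r//.
  by rewrite pmulr_rle0// subr_le0.
- have [C C0 KC] := Kub; exists (C * B) => x x0.
  rewrite /h x0 -x_powRB1// [leRHS](_ : _ = x * (x * (C * (x `^ (a - 1) * x `^ (b - 1)) * B))); last ring.
  rewrite !ler_pM2l// -RintegralZl//.
  apply: le_Rintegral => //; [exact: iK|exact: ibetaZ|].
  move=> t; rewrite /= in_itv/= => t01; rewrite -mulrA; exact: KC.
- move=> fl gl r r0.
  have [c c0 fc] := lower_orderB1 fl r0; have [c' c'0 gc] := lower_orderB1 gl r0.
  have B0 : 0 < B.
    apply: Rintegral_gt0 => //.
      by rewrite lebesgue_measure_itv/= lte_fin ltr01 oppr0 adde0 lte_fin.
    move=> t; rewrite /= in_itv/= => /andP[t0 t1].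
    by rewrite mulr_gt0// powR_gt0// subr_gt0.
  exists (c * c' * B) => [|x /andP[x0 xr]]; first by rewrite !mulr_gt0.
  rewrite /h x0 -x_powRB1// [leLHS](_ : _ = x * (x * (c * c' * (x `^ (a - 1) * x `^ (b - 1)) * B))); last ring.
  rewrite !ler_pM2l// -RintegralZl//.
  apply: le_Rintegral => //; [exact: ibetaZ|exact: iK|].
  move=> t; rewrite /= in_itv/= => /[dup] t01 /andP[t0 t1].
  rewrite -(mulrA (c * c')) -powR_scale// mulrACA.
  have xt0 : 0 < x * t by rewrite mulr_gt0.
  have xt1 : 0 < x * (1 - t) by rewrite mulr_gt0// subr_gt0.
  rewrite ler_pM ?mulr_ge0 ?powR_ge0 ?(ltW c0) ?(ltW c'0)//.
    by apply: fc; rewrite xt1 (le_trans _ xr)// ger_pMr// gerBl ltW.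
  by apply: gc; rewrite xt0 (le_trans _ xr)// ger_pMr// ltW.
Qed.

End sum.
End pos_density.

Lemma measurable_inv (R : realType) :
  measurable_fun [set: measurableTypeR R] (@GRing.inv R : measurableTypeR R -> measurableTypeR R).
Proof.
rewrite -(setUv [set 0 : R]); apply/measurable_funU => //.
  exact: measurableC.
split; first exact: measurable_fun_set1.
apply: open_continuous_measurable_fun.
  by rewrite openC; exact: closed_eq.
by move=> x; rewrite inE/= => /eqP x0; exact: inv_continuous.
Qed.

Section prod.
Context {R : realType}.
Local Notation TR := (measurableTypeR R).
Local Notation mu := (@lebesgue_measure R).
Variables (f g : R -> R) (b : R).
Hypotheses (fP : pos_density f) (gP : pos_density g) (b0 : 0 < b).
Hypothesis ig : mu.-integrable [set: TR] (EFin \o g).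
Hypothesis fu0 : upper_order f 0.
Hypotheses (gu : upper_order g b) (gl : lower_order g b).

(* psi x = x h(x) is the multiplicative convolution of u f(u) and y g(y). *)
Let K x y := x / y * f (x / y) * g y.
Let psi x := \int[mu]_(y in [set: TR]) K x y.
Let h x := if 0 < x then x^-1 * psi x else 0.

Let mf := measurable_pos_density fP.
Let mg := measurable_pos_density gP.

Let mdiv x : measurable_fun [set: TR] (fun y : TR => x / y).
Proof.
by apply: measurable_funM => //; exact: measurable_inv.
Qed.

Let mK x : measurable_fun [set: TR] (K x).
Proof.
apply: measurable_funM; last exact: mg.
apply: measurable_funM; first exact: mdiv.
by apply: (measurableT_comp mf); exact: mdiv.
Qed.

Let KN x y : y <= 0 -> K x y = 0.
Proof. by case: gP => gN _ _ y0; rewrite /K gN ?mulr0. Qed.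

Let K0 x y : 0 < x -> 0 <= K x y.
Proof.
move=> x0; have [/KN->//|y0] := leP y 0.
by case: fP gP => _ f0 _ [_ g0 _]; rewrite !mulr_ge0// ?invr_ge0 ltW.
Qed.

Let Kub z : upper_order f z ->
  exists2 C, 0 <= C & forall x y, 0 < x -> 0 < y -> K x y <= C * (x / y) `^ z * g y.
Proof.
move=> [C fC]; exists (Num.max 0 C); first by rewrite le_max lexx.
move=> x y x0 y0; have xy0 : 0 < x / y by rewrite divr_gt0.
case: gP => _ g0 _; rewrite ler_wpM2r// (le_trans (fC _ xy0))//.
by rewrite ler_wpM2r ?powR_ge0// le_max lexx orbT.
Qed.

(** Boundedness of [u f(u)] gives one integrable majorant for every [x], used for both integrability
    and continuity. *)
Let Kub0 : exists2 C, 0 <= C & forall x y, 0 < x -> K x y <= C * g y.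
Proof.
have [C C0 KC] := Kub fu0; exists C => // x y x0.
have [y0|y0] := leP y 0.
  by rewrite KN//; case: gP => _ g0 _; rewrite mulr_ge0.
by rewrite (le_trans (KC _ _ x0 y0))// powRr0 mulr1.
Qed.

Let igZ C : mu.-integrable [set: TR] (fun t : TR => (C * g t)%:E).
Proof. exact: (@integrableZl _ _ _ mu setT measurableT C _ ig). Qed.

Let iK x : 0 < x -> mu.-integrable [set: TR] (EFin \o K x).
Proof.
move=> x0; have [C C0 KC] := Kub0; case: gP => _ g0 _.
apply: le_integrable (igZ C) => //.
- by apply/measurable_EFinP; exact: mK.
- move=> t _; rewrite lee_fin (ger0_norm (K0 _ x0)) ger0_norm ?mulr_ge0//.
  exact: KC.
Qed.

Let hc : continuous_on_pos h.
Proof.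
move=> x x0.
apply: (@continuous_near _ _ (fun y => y^-1 * psi y)).
  near=> y; rewrite /h ifT//; near: y; exact: lt_nbhsr.
apply: cvgM; first by apply: inv_continuous; rewrite gt_eqF.
have [C C0 KC] := Kub0; case: (gP) => _ g0 _.
pose u := x / 2; pose v := x * 2.
have u0 : 0 < u by rewrite divr_gt0.
have Ipos y : y \in `]u, v[ -> 0 < y.
  by rewrite in_itv/= => /andP[+ _]; apply: lt_trans.
apply: (@continuity_under_integral R _ TR mu K setT _ u v _ _ (fun t => C * g t)).
- exact: measurableT.
- by move=> y /Ipos; exact: iK.
- apply: aeW => t _ y; rewrite inE => /Ipos y0.
  have [t0|t0] := leP t 0.
    rewrite (_ : K^~ t = cst 0); first exact: cst_continuous.
    by apply/funext => z; rewrite KN.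
  have yt0 : 0 < y / t by rewrite divr_gt0.
  case: fP => _ _ fc.
  have ct : {for y, continuous (fun z : R => z / t)} by exact: mulrr_continuous.
  apply: cvgM; last exact: cvg_cst.
  apply: cvgM; first exact: ct.
  have : {for y, continuous (f \o (fun z : R => z / t))}.
    by apply: continuous_comp => //; exact: fc.
  exact.
- exact: igZ.
- move=> y /Ipos y0; apply: aeW => t _.
  by rewrite ger0_norm ?K0// KC.
- by rewrite inE/= in_itv/=; apply/andP; split; rewrite /u /v; lra.
Unshelve. all: by end_near. Qed.

Let x_h x : 0 < x -> x * h x = psi x.
Proof. by move=> x0; rewrite /h x0 mulrA divff ?mul1r// gt_eqF. Qed.

Let psi_lb (D : set TR) (k : R -> R) x : measurable D -> 0 < x ->
  mu.-integrable D (EFin \o k) -> (forall y, D y -> k y <= K x y) ->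
  \int[mu]_(y in D) k y <= psi x.
Proof.
move=> mD x0 ik kK.
have iKD : mu.-integrable D (EFin \o K x) by apply: integrableS (iK x0).
apply: (@le_trans _ _ (\int[mu]_(y in D) K x y)); first exact: le_Rintegral.
apply: fine_le.
- exact: integrable_fin_num.
- by apply: integrable_fin_num (iK x0); exact: measurableT.
- apply: ge0_subset_integral => //.
    by apply/measurable_EFinP; exact: mK.
  by move=> y _; rewrite lee_fin K0.
Qed.

(** Near 0 the integrand is at most a multiple of [y^(b - z - 1)], integrable because [z < b]; from
    1 on, [y^(-z) <= 1] and [g] itself dominates. *)
Let moment z : 0 <= z < b ->
  mu.-integrable [set: TR] (fun y : TR => (y `^ (- z) * g y)%:E).
Proof.
move=> /andP[z0 zb]; case: gP => gN g0 _.
have bz : 0 < b - z by rewrite subr_gt0.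
have [C C0 gC] := upper_orderB1 gu.
have mp r : measurable_fun [set: TR] (fun t : TR => t `^ r) by exact: measurable_powR.
pose k := (fun y : TR => C * y `^ (b - z - 1)) \_ `]0, 1[.
have ik : mu.-integrable [set: TR] (EFin \o k).
  have mI : measurable (`]0, 1[%classic : set TR) by exact: measurable_itv.
  rewrite /k -restrict_EFin.
  apply: (iffLR (integrable_mkcond (EFin \o (fun y : TR => C * y `^ (b - z - 1))) mI)).
  exact: (@integrableZl _ _ _ mu `]0, 1[%classic (measurable_itv _) C _ (integrable_powR bz)).
apply: (@le_integrable _ _ _ _ _ _ _ (fun y : TR => (k y)%:E + (g y)%:E)%E) => //.
- by apply/measurable_EFinP/measurable_funM => //; exact: mp.
- move=> y _; rewrite lee_fin.
  have k0 : 0 <= k y.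
    by rewrite /k patchE; case: ifPn => // _; rewrite mulr_ge0 ?powR_ge0.
  rewrite !ger0_norm ?addr_ge0 ?mulr_ge0 ?powR_ge0//.
  have [y0|y0] := leP y 0; first by rewrite gN// mulr0 addr_ge0 ?gN.
  have [y1|y1] := ltP y 1.
    rewrite ler_wpDr// /k patchE mem_setE in_itv/= y0 y1/=.
    have -> : b - z - 1 = - z + (b - 1) by ring.
    by rewrite pos_powRD// mulrCA ler_wpM2l ?powR_ge0// gC.
  rewrite ler_wpDl// ler_piMl//.
  by rewrite powRN invf_le1 ?powR_gt0// -[leLHS](powRr0 y) ler_powR.
- exact: integrableD.
Qed.

Let upper_h z : 0 <= z < b -> upper_order f z -> upper_order h z.
Proof.
move=> zb /Kub[C C0 KC]; have imz := moment zb.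
exists (C * \int[mu]_(y in [set: TR]) (y `^ (- z) * g y)) => x x0.
rewrite x_h// mulrAC -RintegralZl//.
apply: le_Rintegral => //; first exact: iK.
  exact: (@integrableZl _ _ _ mu setT measurableT _ _ imz).
move=> y _; have [y0|y0] := leP y 0.
  by rewrite KN//; case: gP => gN _ _; rewrite gN// !mulr0.
rewrite (le_trans (KC _ _ x0 y0))// powRM ?invr_ge0 ?(ltW x0) ?(ltW y0)//.
by rewrite -powR_inv1 ?(ltW y0)// -powRrM mulN1r !mulrA.
Qed.

Let g_gt0 y : 0 < y -> 0 < g y.
Proof.
move=> y0; have [c c0 gc] := gl y0.
rewrite -(pmulr_rgt0 _ y0) (lt_le_trans _ (gc y _)) ?y0 ?lexx//.
by rewrite mulr_gt0 ?powR_gt0.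
Qed.

(* The window y in ]1, 2[ transfers the exponent of f. *)
Let lower_h_l a : 0 < a -> lower_order f a -> lower_order h a.
Proof.
move=> a0 fl r r0; have [c c0 fc] := fl r r0.
pose D : set TR := `]1, 2[%classic.
have mD : measurable D by exact: measurable_itv.
have mp q : measurable_fun [set: TR] (fun t : TR => t `^ q) by exact: measurable_powR.
have ik : mu.-integrable D (fun y : TR => (y `^ (- a) * g y)%:E).
  apply: (@le_integrable _ _ _ _ _ _ _ (fun y : TR => (g y)%:E)) => //.
  - by apply/measurable_EFinP/measurable_funTS/measurable_funM => //; exact: mp.
  - move=> y; rewrite /D/= in_itv/= => /andP[y1 _]; rewrite lee_fin.
    case: gP => _ g0 _; rewrite !ger0_norm ?mulr_ge0 ?powR_ge0// ler_piMl//.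
    rewrite powRN invf_le1 ?powR_gt0// ?(lt_trans _ y1)//.
    by rewrite -[leLHS](powRr0 y) ler_powR// ltW.
  - exact: integrableS ig.
exists (c * \int[mu]_(y in D) (y `^ (- a) * g y)).
  rewrite mulr_gt0//; apply: Rintegral_gt0 => //.
    by rewrite lebesgue_measure_itv/= lte_fin ltr1n -EFinB lte_fin subr_gt0 ltr1n.
  move=> y; rewrite /D/= in_itv/= => /andP[y1 _].
  by rewrite mulr_gt0 ?powR_gt0 ?g_gt0// (lt_trans _ y1).
move=> x /andP[x0 xr]; rewrite x_h// mulrAC -RintegralZl//.
apply: psi_lb => //.
  exact: (@integrableZl _ _ _ mu D (measurable_itv _) _ _ ik).
move=> y; rewrite /D/= in_itv/= => /andP[y1 _].
have y0 : 0 < y by rewrite (lt_trans _ y1).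
rewrite mulrA; case: gP => _ g0 _; rewrite ler_wpM2r//.
have xy : 0 < x / y <= r.
  by rewrite divr_gt0//= ler_pdivrMr// (le_trans xr)// ler_peMr// ltW.
rewrite (le_trans _ (fc _ xy))// powRM ?invr_ge0 ?(ltW x0) ?(ltW y0)//.
by rewrite -powR_inv1 ?(ltW y0)// -powRrM mulN1r !mulrA.
Qed.

(* On the window y in ]x, 2 x[, x / y stays in [1/2, 1], which transfers the
   exponent of g. *)
Let lower_h_r a : 0 < a -> lower_order f a -> lower_order h b.
Proof.
move=> a0 fl r r0; have [c c0 fc] := fl 1 ltr01.
have r20 : 0 < 2 * r by rewrite mulr_gt0.
have [c' c'0 gc] := gl r20.
(* The first factor bounds [u f(u)] for [u] at least 1/2. On the window [g y] is at least
   [c' x^b / (2 x)], and the window length [x] cancels the denominator up to the 2. *)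
exists (c * 2^-1 `^ a * (c' / 2)).
  by rewrite !mulr_gt0 ?powR_gt0// invr_gt0.
move=> x /andP[x0 xr]; rewrite x_h//.
pose D : set TR := `]x, 2 * x[%classic.
have mD : measurable D by exact: measurable_itv.
have muD : mu D = x%:E.
  rewrite lebesgue_measure_itv/= lte_fin ifT; last by lra.
  by rewrite -EFinB; congr EFin; ring.
pose k := c * 2^-1 `^ a * (c' * x `^ b / (2 * x)).
rewrite [leLHS](_ : _ = \int[mu]_(y in D) cst k y); last first.
  rewrite Rintegral_cst// [fine _](_ : _ = x); last by rewrite [X in fine X]muD.
  by rewrite /k/=; field; rewrite gt_eqF.
apply: psi_lb => //.
  apply/integrableP; split; first exact/measurable_EFinP.
  rewrite (eq_integral (cst `|k|%:E))// integral_cst//.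
  by rewrite [X in (_ * X)%E]muD ltry.
move=> y; rewrite /D/= in_itv/= => /andP[xy yx].
have y0 : 0 < y by rewrite (lt_trans x0).
rewrite /k /K; apply: ler_pM.
- by rewrite mulr_ge0 ?powR_ge0 ?(ltW c0).
- by rewrite divr_ge0 ?mulr_ge0 ?powR_ge0 ?(ltW c'0) ?(ltW x0).
- have h1 : 2^-1 <= x / y by rewrite ler_pdivlMr//; lra.
  have h2 : 0 < x / y <= 1 by rewrite divr_gt0//= ler_pdivrMr// mul1r ltW.
  rewrite (le_trans _ (fc _ h2))// ler_wpM2l ?(ltW c0)//.
  by rewrite ge0_ler_powR ?nnegrE ?(ltW a0)// divr_ge0 ?(ltW x0) ?(ltW y0).
have h3 : 0 < y <= 2 * r by rewrite y0/=; lra.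
have h4 := gc _ h3.
rewrite ler_pdivrMr ?mulr_gt0// mulrC.
apply: le_trans (_ : y * g y <= _); last first.
  by rewrite mulrC ler_wpM2l ?(ltW yx)//; case: gP.
rewrite (le_trans _ h4)// mulrC ler_wpM2l ?(ltW c'0)//.
by rewrite ge0_ler_powR ?nnegrE ?(ltW b0) ?(ltW x0) ?(ltW y0) ?(ltW xy).
Qed.

(** The factor [f (x / y) / y] is the density of [y X] for [y > 0]. In the last clause the lower
    bound on [f] keeps it away from 0 on the interval from 1/2 to 1, so the exponent comes from
    [g]. *)
Lemma prod_density : exists h, [/\ pos_density h,
  forall x, (\int[mu]_y ((if 0 < y then f (x / y) / y else 0) * g y)%:E)%E = (h x)%:E,
  forall z, 0 <= z < b -> upper_order f z -> upper_order h z,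
  forall a, 0 < a -> lower_order f a -> lower_order h a &
  forall a, 0 < a -> lower_order f a -> lower_order h b].
Proof.
exists h; split => //.
- split; last exact: hc.
  + by move=> x x0; rewrite /h ltNge x0.
  + move=> x; rewrite /h; case: ifPn => // x0; rewrite mulr_ge0 ?invr_ge0 ?(ltW x0)//.
    by apply: Rintegral_ge0 => t _; exact: K0.
- move=> x; rewrite /h; case: ltP => [x0|x0]; last first.
    rewrite integral0_eq// => y _; case: ltP => y0; last by rewrite mul0r.
    by case: fP => fN _ _; rewrite fN ?mul0r// pmulr_lle0// invr_gt0.
  rewrite EFinM -[(psi x)%:E]/((fine _)%:E) fineK; last first.
    by apply: integrable_fin_num (iK x0) => //; exact: measurableT.
  rewrite -ge0_integralZl//; last 3 first.
  + by apply/measurable_EFinP; exact: mK.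
  + by move=> y _; rewrite lee_fin K0.
  + by rewrite lee_fin invr_ge0 ltW.
  apply: eq_integral => y _; rewrite -EFinM; congr EFin.
  case: ltP => y0; last by rewrite KN// mul0r mulr0.
  by rewrite /K; field; rewrite !gt_eqF.
Qed.

End prod.

(** * Gamma-gamma densities *)

Section gamma_gamma.
Context {R : realType} {d} {T : measurableType d} (P : probability T R).
Local Notation TR := (measurableTypeR R).
Local Notation mu := (@lebesgue_measure R).
Variables (X : T -> R) (lam c : R).
Hypotheses (lam0 : 0 < lam) (c0 : 0 < c).
Hypothesis XP : has_density P X (gg_pdf lam c 1).

Let g := gg_pdf lam c 1.
Let k := (1^-1) `^ lam * (Gamma (lam + c) / (Gamma lam * Gamma c)) : R.

Let gE x : 0 < x -> g x = k * x `^ (lam - 1) * (1 + x) `^ (- (lam + c)).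
Proof. by move=> x0; rewrite /g /gg_pdf x0 divr1. Qed.

Let g_int : (\int[mu]_x (g x)%:E = 1)%E.
Proof. by rewrite -XP// preimage_setT probability_setT. Qed.

(* The density has total mass 1, so the normalising constant cannot vanish; this
   spares the positivity of the Gamma function. *)
Let k0 : 0 < k.
Proof.
have Gamma_ge0 a : 0 <= @Gamma R a.
  by apply: Rintegral_ge0 => x _; rewrite mulr_ge0 ?powR_ge0 ?expR_ge0.
have k_ge0 : 0 <= k by rewrite mulr_ge0 ?powR_ge0// divr_ge0// mulr_ge0.
rewrite lt_neqAle k_ge0 andbT; apply/eqP => kE.
have := g_int; rewrite integral0_eq; first by move/esym/eqP; rewrite onee_eq0.
move=> x _; congr EFin; have [x0|x0] := ltP 0 x; first by rewrite gE// -kE !mul0r.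
by rewrite /g /gg_pdf ltNge x0.
Qed.

Let lamc0 : 0 < lam + c. Proof. by rewrite addr_gt0. Qed.

Let x_gE x : 0 < x -> x * g x = k * x `^ lam * (1 + x) `^ (- (lam + c)).
Proof. by move=> x0; rewrite gE// mulrA mulrCA mulr_powRB1// ltW. Qed.

Let decay_le1 (x r : R) : 0 < x -> 0 <= r -> (1 + x) `^ (- r) <= 1.
Proof.
move=> x0 r0; have x1 : 1 <= 1 + x by rewrite lerDl ltW.
have x10 := lt_le_trans ltr01 x1.
by rewrite powRN invf_le1 ?powR_gt0// -[leLHS](powRr0 (1 + x)) ler_powR.
Qed.

Lemma gg_pos_density : pos_density (gg_pdf lam c 1).
Proof.
split.
- by move=> x x0; rewrite /gg_pdf ltNge x0.
- move=> x; have [x0|x0] := ltP 0 x; last by rewrite /gg_pdf ltNge x0.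
  by rewrite -/g gE//; exact: mulr_ge0 (mulr_ge0 (ltW k0) (powR_ge0 _ _)) (powR_ge0 _ _).
- move=> x x0.
  apply: (@continuous_near _ _
    (fun x => k * x `^ (lam - 1) * (1 + x) `^ (- (lam + c)))).
    by near=> y; rewrite -/g gE//; near: y; exact: lt_nbhsr.
  apply: cvgM; first by apply: cvgM; [exact: cvg_cst|exact: continuous_powR].
  have c1 : {for x, continuous (fun x : R => 1 + x)}.
    by apply: cvgD; [exact: cvg_cst|exact: cvg_id].
  have : {for x, continuous ((fun y : R => y `^ (- (lam + c))) \o (fun x => 1 + x))}.
    by apply: continuous_comp => //; apply: continuous_powR; rewrite addr_gt0.
  exact.
Unshelve. all: by end_near. Qed.

Lemma gg_integrable : mu.-integrable [set: TR] (EFin \o gg_pdf lam c 1).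
Proof.
case: gg_pos_density => _ g0 _; apply/integrableP; split.
  by apply/measurable_EFinP; exact: measurable_pos_density gg_pos_density.
under eq_integral do rewrite gee0_abs ?lee_fin//.
by rewrite [X in (X < _)%E]g_int ltry.
Qed.

(** Up to 1, [x^lam <= x^z] since [z <= lam]; beyond 1, the decay [(1 + x)^(-lam)] absorbs [x^lam],
    leaving at most 1, which is at most [x^z] since [z] is nonnegative. *)
Lemma gg_upper_order z : 0 <= z <= lam -> upper_order (gg_pdf lam c 1) z.
Proof.
move=> /andP[z0 zl]; exists k => x x0; rewrite x_gE// -mulrA ler_wpM2l ?(ltW k0)//.
have [x1|x1] := leP x 1.
  rewrite -[leRHS]mulr1 ler_pM ?powR_ge0//; last exact/decay_le1/ltW.
  by apply: ger_powR => //; rewrite x0.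
have x1x : 0 < 1 + x by rewrite addr_gt0.
rewrite opprD pos_powRD// mulrA -[leRHS]mulr1 ler_pM ?mulr_ge0 ?powR_ge0//; last first.
  exact/decay_le1/ltW.
apply: (@le_trans _ _ 1).
  rewrite powRN ler_pdivrMr ?powR_gt0// mul1r.
  by rewrite ge0_ler_powR ?nnegrE ?(ltW lam0) ?(ltW x0) ?(ltW x1x)// lerDr.
by rewrite -[leLHS](powRr0 x) ler_powR// ltW.
Qed.

Lemma gg_lower_order : lower_order (gg_pdf lam c 1) lam.
Proof.
move=> b b0; have b10 : 0 < 1 + b by rewrite addr_gt0.
(* The decay factor is decreasing, so its value at [b] is a lower bound for it on the whole
   interval. *)
exists (k * (1 + b) `^ (- (lam + c))) => [|x /andP[x0 xb]].
  by rewrite mulr_gt0 ?powR_gt0.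
have x1x : 0 < 1 + x by rewrite addr_gt0.
rewrite x_gE// mulrAC; apply: ler_wpM2l.
  exact: mulr_ge0 (ltW k0) (powR_ge0 _ _).
rewrite !powRN lef_pV2 ?posrE ?powR_gt0//.
by rewrite ge0_ler_powR ?nnegrE ?(ltW lamc0) ?(ltW x1x) ?(ltW b10)// lerD2l.
Qed.

End gamma_gamma.

(** * Densities of partial sums and partial products *)

Section partial_densities.
Context {R : realType} {d} {T : measurableType d} (P : probability T R).
Local Notation TR := (measurableTypeR R).
Local Notation mu := (@lebesgue_measure R).
Variables (n : nat) (eta : nat -> {mfun T >-> TR}) (g : nat -> R -> R).
Variable lam : nat -> R.
Hypothesis eta_indep : forall B : nat -> set TR, (forall i, measurable (B i)) ->
  P [set w | forall j, (j < n.+1)%N -> B j (eta j w)] =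
  (\prod_(0 <= j < n.+1) P (eta j @^-1` B j))%E.
Hypothesis gP : forall i, pos_density (g i).
Hypothesis etaP : forall i, has_density P (eta i) (g i).
Hypothesis lam0 : forall i, 0 < lam i.
Hypothesis ig : forall i, mu.-integrable [set: TR] (EFin \o g i).
Hypothesis gu : forall i z, 0 <= z <= lam i -> upper_order (g i) z.
Hypothesis gl : forall i, lower_order (g i) (lam i).

Lemma measurable_add2 : measurable_fun [set: TR * TR] (fun z : TR * TR => z.1 + z.2 : TR).
Proof. by apply: measurable_funD. Qed.

Lemma measurable_mul2 : measurable_fun [set: TR * TR] (fun z : TR * TR => z.1 * z.2 : TR).
Proof. by apply: measurable_funM. Qed.

Let upper_id i : upper_order (g i) (lam i).
Proof. by apply: gu; rewrite lexx ltW. Qed.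

Lemma partial_sum_density k : (k <= n)%N -> exists f, [/\ pos_density f,
  has_density P (partial_op measurable_add2 eta k) f,
  upper_order f (\sum_(j < k.+1) lam j) & lower_order f (\sum_(j < k.+1) lam j)].
Proof.
elim: k => [_|k IH kn].
  exists (g 0); rewrite big_ord1.
  by split; [exact: gP|exact: etaP|exact: upper_id|exact: gl].
have [f [fP fd fu fl]] := IH (ltnW kn).
have s0 : 0 < \sum_(j < k.+1) lam j.
  by rewrite big_ord_recl ltr_pwDl// sumr_ge0// => i _; exact: ltW.
have [h [hP hE hu hl]] := sum_density fP (gP k.+1) s0 (lam0 k.+1) fu (upper_id k.+1).
exists h; rewrite big_ord_recr/=; split => //; last exact: hl.
move=> A mA; case: (fP) (gP k.+1) => _ f0 _ [_ g0 _].
have mf := measurable_pos_density fP.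
have mg := measurable_pos_density (gP k.+1).
transitivity (\int[mu]_(u in A) \int[mu]_y (f (u - y) * g k.+1 y)%:E)%E; last first.
  by apply: eq_integral => u _; exact: hE.
apply: (@op_density _ _ _ _ _ _ _ _ (fun u y => f (u - y)) measurable_add2) => //.
- by apply: (measurableT_comp mf); exact: measurable_funB.
- exact: etaP.
- move=> y _ B mB.
  rewrite fd; last first.
    rewrite -[_ @^-1` _]setTI; apply: (measurable_funD (f := id) (g := cst y)) => //.
  rewrite integral_mkcond [RHS]integral_mkcond.
  rewrite [RHS](@ge0_integral_affine _ 1 y) ?oner_eq0//.
  + rewrite normr1 mul1e; apply: eq_integral => x _.
    rewrite !patchE mul1r addrK.
    have -> // : (x \in (fun x => x + y) @^-1` B) = (x + y \in B).
    by apply/idP/idP; rewrite !inE.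
  + apply/(measurable_restrictT (fun u : R => (f (u - y))%:E)) => //.
    apply/measurable_EFinP/measurable_funTS; apply: (measurableT_comp mf).
    exact: measurable_funB.
  + by move=> u; apply: erestrict_ge0 => ? _; rewrite lee_fin.
- by move=> C mC; exact: (partial_op_joint_law measurable_add2 eta_indep).
Qed.

(** Bounds are stated against each exponent separately, so no minimum is tracked through the
    induction; a minimising index is picked only at the end. *)
Lemma partial_prod_density k : (k <= n)%N -> exists f, [/\ pos_density f,
  has_density P (partial_op measurable_mul2 eta k) f,
  forall z, 0 <= z -> (forall j, (j <= k)%N -> z < lam j) -> upper_order f z &
  forall j, (j <= k)%N -> lower_order f (lam j)].
Proof.
elim: k => [_|k IH kn].
  exists (g 0); split; [exact: gP|exact: etaP| |by move=> [|//] _].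
  by move=> z z0 /(_ 0%N isT) zl; apply: gu; rewrite z0 ltW.
have [f [fP fd fu fl]] := IH (ltnW kn).
have fu0 : upper_order f 0 by apply: fu => // j _.
have [h [hP hE hu hl hr]] := prod_density fP (gP k.+1) (lam0 k.+1) (@ig k.+1) fu0
  (upper_id k.+1) (@gl k.+1).
exists h; split => //; last 2 first.
- move=> z z0 zl; apply: hu; first by rewrite z0 zl.
  by apply: fu => // j jk; apply: zl; rewrite (leq_trans jk).
(* The new exponent comes from the new factor, and any earlier lower bound, here that of index 0,
   serves for the partial product. *)
- move=> j; rewrite leq_eqVlt => /predU1P[->|jk]; first exact: hr (fl 0%N isT).
  by apply: hl => //; exact: fl.
move=> A mA; case: (fP) (gP k.+1) => _ f0 _ [gN g0 _].
have mf := measurable_pos_density fP.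
have mg := measurable_pos_density (gP k.+1).
transitivity (\int[mu]_(u in A) \int[mu]_y
    ((if (0 < y)%R then f (u / y) / y else 0) * g k.+1 y)%:E)%E; last first.
  by apply: eq_integral => u _; exact: hE.
apply: (@op_density _ _ _ _ _ _ _ _
  (fun u y => if (0 < y) then f (u / y) / y else 0) measurable_mul2) => //.
- have mV : measurable_fun [set: TR * TR] (fun z : TR * TR => z.2^-1 : TR).
    by apply: (measurableT_comp (@measurable_inv R)); exact: measurable_snd.
  apply: measurable_fun_ifT => //.
  + by apply: measurable_fun_ltr => //; exact: measurable_snd.
  + apply: measurable_funM => //; apply: (measurableT_comp mf).
    by apply: measurable_funM => //; exact: measurable_fst.
- by move=> u y; case: ifPn => // y0; rewrite mulr_ge0// invr_ge0 ltW.
- exact: etaP.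
- move=> y gy B mB.
  (* The density of the new factor is nonzero only at positive [y], where multiplication by [y] is
     an invertible dilation. *)
  have y0 : 0 < y by rewrite ltNge; apply: contra gy => /gN ->.
  rewrite fd; last first.
    rewrite -[_ @^-1` _]setTI; apply: (measurable_funM (f := id) (g := cst y)) => //.
  rewrite y0 integral_mkcond [RHS]integral_mkcond.
  pose F : TR -> \bar R := (fun u : R => (f (u / y) / y)%:E) \_ B.
  have mF : measurable_fun [set: TR] F.
    apply/(measurable_restrictT (fun u : R => (f (u / y) / y)%:E)) => //.
    apply/measurable_EFinP/measurable_funTS/measurable_funM => //.
    by apply: (measurableT_comp mf); exact: measurable_funM.
  have F0 u : (0 <= F u)%E.
    by apply: erestrict_ge0 => ? _; rewrite lee_fin mulr_ge0// invr_ge0 ltW.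
  rewrite [RHS](@ge0_integral_affine _ y 0 F) ?gt_eqF//.
  rewrite gtr0_norm// -ge0_integralZl//.
  + apply: eq_integral => x _; rewrite /F !patchE addr0 [y * x]mulrC.
    have -> : (x \in (fun x => x * y) @^-1` B) = (x * y \in B).
      by apply/idP/idP; rewrite !inE.
    case: ifPn => _; last by rewrite mule0.
    by rewrite -EFinM mulfK ?gt_eqF// mulrC divfK ?gt_eqF.
  + apply: (measurableT_comp mF).
    by apply: measurable_funD => //; exact: measurable_funM.
  + by rewrite lee_fin ltW.
- by move=> C mC; exact: (partial_op_joint_law measurable_mul2 eta_indep).
Qed.

End partial_densities.

(** * From the family of random variables to its partial results *)

Section assembly.
Context {R : realType} {d} {T : measurableType d} (P : probability T R).
Local Notation TR := (measurableTypeR R).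

(* The Borel structures of R and of the domain of the Lebesgue measure are
   convertible but carry different displays. *)
Definition mfun_of_RV (X : {RV P >-> R}) : {mfun T >-> TR} :=
  HB.pack (X : T -> TR)
    (isMeasurableFun.Build _ _ T TR (X : T -> TR) (measurable_funPT X)).

(** The recursion runs over natural numbers, so the family is extended by [inord], which repeats
    index 0 beyond [n]; the bound on [j] keeps these repetitions out of the independence
    statement. *)
Lemma mutually_independent_nat n (eta : 'I_n.+1 -> {RV P >-> R}) :
  mutually_independent eta -> forall B : nat -> set TR,
  (forall i, measurable (B i)) ->
  P [set w | forall j, (j < n.+1)%N -> B j (mfun_of_RV (eta (inord j)) w)] =
  (\prod_(0 <= j < n.+1) P (mfun_of_RV (eta (inord j)) @^-1` B j))%E.
Proof.
move=> ind B mB; rewrite big_mkord.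
under eq_bigr do rewrite inord_val.
rewrite -(ind (fun i => B i)) => [|i]; last exact: mB.
congr (P _); apply/seteqP; split => w /=.
  by move=> H i _ /=; have := H i (ltn_ord i); rewrite inord_val.
by move=> H j jn; have := H (inord j) I; rewrite /= inordK.
Qed.

Lemma partial_sumE m1 (eta : nat -> {mfun T >-> TR}) k w :
  partial_op (S := TR) (op := fun x y : TR => x + y) m1 eta k w = \sum_(j < k.+1) eta j w.
Proof.
elim: k => [|k IH]; first by rewrite big_ord1.
by rewrite big_ord_recr/= -IH.
Qed.

Lemma partial_prodE m1 (eta : nat -> {mfun T >-> TR}) k w :
  partial_op (S := TR) (op := fun x y : TR => x * y) m1 eta k w = \prod_(j < k.+1) eta j w.
Proof.
elim: k => [|k IH]; first by rewrite big_ord1.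
by rewrite big_ord_recr/= -IH.
Qed.

End assembly.

Unset Implicit Arguments.

Theorem theorem2 (R : realType) (d : measure_display) (T : measurableType d)
  (P : probability T R) (K : nat) (lam c : 'I_K -> R)
  (eta : 'I_K -> {RV P >-> R}) :
  (0 < K)%N ->
  (forall i, 0 < lam i) -> (forall i, 0 < c i) ->
  mutually_independent eta ->
  (forall i, has_density P (eta i) (gg_pdf (lam i) (c i) 1)) ->
  sparsity_of_rv_is P (fun w => \prod_(i < K) eta i w)
    (\big[Order.min/+oo%E]_(i < K) (lam i)%:E)%E /\
  sparsity_of_rv_is P (fun w => \sum_(i < K) eta i w)
    (\sum_(i < K) lam i)%:E.
Proof.
case: K lam c eta => [//|n] lam c eta _ lam0 c0 ind etaP.
pose eta' j := mfun_of_RV (eta (inord j)).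
pose g j := gg_pdf (lam (inord j)) (c (inord j)) 1.
pose lam' j := lam (inord j).
have eta'E (i : 'I_n.+1) w : eta' i w = eta i w by rewrite /eta' inord_val.
have eta'P i : has_density P (eta' i) (g i) by exact: etaP.
have gP i : pos_density (g i).
  exact: gg_pos_density (etaP _).
have ig i : lebesgue_measure.-integrable [set: measurableTypeR R] (EFin \o g i).
  exact: gg_integrable (etaP _).
have gu i z : 0 <= z <= lam' i -> upper_order (g i) z.
  by move=> zl; apply: (gg_upper_order (lam0 _) (c0 _) (etaP _)).
have gl i : lower_order (g i) (lam' i).
  exact: gg_lower_order (lam0 _) (c0 _) (etaP _).
have lam'0 i : 0 < lam' i by exact: lam0.
have ind' := mutually_independent_nat ind.
split.
- have [f [fP fd fu fl]] := partial_prod_density ind' gP eta'P lam'0 ig gu gl (leqnn n).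
  have fX : has_density P (fun w => \prod_(i < n.+1) eta i w) f.
    move=> A mA; rewrite -fd//; congr (P _); apply/seteqP; split => w /=;
    rewrite partial_prodE; by rewrite (eq_bigr _ (fun i _ => eta'E i w)).
  (* The index set is nonempty, so the minimum is attained rather than equal to the default [+oo];
     the lower bound of the attaining index gives the exponent. *)
  have [i0 _ minE] : {i0 | i0 \in 'I_n.+1 &
      (\big[Order.min/+oo]_(i < n.+1) (lam i)%:E = (lam i0)%:E)%E}.
    by apply: (eq_bigmin ord0) => // i _; exact: leey.
  have lam_min i : lam i0 <= lam i by rewrite -lee_fin -minE bigmin_le.
  rewrite minE; case: fP => _ f0 fc; apply: (sparsity_of_rv_is_bounds fX) => //.
  + move=> z /andP[z0 zl].
    have [C fC] : upper_order f z.
      by apply: fu => // j _; apply: lt_le_trans zl _; exact: lam_min.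
    by exists C => x /andP[x0 _]; exact: fC.
  + have [k k0 fk] := fl i0 (leq_ord i0) 1 ltr01.
    by exists k => // x x01; have := fk x x01; rewrite /lam' inord_val.
- have [f [fP fd fu fl]] := partial_sum_density ind' gP eta'P lam'0 gu gl (leqnn n).
  have fX : has_density P (fun w => \sum_(i < n.+1) eta i w) f.
    move=> A mA; rewrite -fd//; congr (P _); apply/seteqP; split => w /=;
    rewrite partial_sumE; by rewrite (eq_bigr _ (fun i _ => eta'E i w)).
  have lamE : \sum_(i < n.+1) lam' i = \sum_(i < n.+1) lam i.
    by apply: eq_bigr => i _; rewrite /lam' inord_val.
  rewrite lamE in fu fl.
  case: fP => _ f0 fc; apply: (sparsity_of_rv_is_bounds fX) => //.
  + by rewrite big_ord_recl ltr_pwDl// sumr_ge0// => i _; exact: ltW.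
  (* A nonnegative constant is needed to pass from the exponent of the sum to the smaller [z], using
     that powers decrease in the exponent on [x <= 1]. *)
  + move=> z /andP[z0 zl]; have [C fC] := fu; exists (Num.max 0 C) => x /andP[x0 x1].
    have xz : x `^ (\sum_(i < n.+1) lam i) <= x `^ z.
      by apply: ger_powR; rewrite ?x0// ltW.
    rewrite (le_trans (fC _ x0))//.
    apply: (@le_trans _ _ (Num.max 0 C * x `^ (\sum_(i < n.+1) lam i))).
      by rewrite ler_wpM2r ?powR_ge0// le_max lexx orbT.
    by rewrite ler_wpM2l// le_max lexx.
  + by have [k k0 fk] := fl 1 ltr01; exists k.
Qed.
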